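(* Let $m,l$ be nonnegative integers and let $\alpha,a,b,b_1,\dots,b_m,c_1,\dots,c_m$ be complex numbers with $$\max\{|\alpha a|,|\alpha b|,|\alpha b_1|,|\alpha a c_1/q|,\dots,|\alpha b_m|,|\alpha a c_m/q|\}<1 .$$ Then $$(a/q)^l\,\frac{(\alpha q,\alpha ab/q;q)_\infty}{(\alpha a,\alpha b;q)_\infty}\prod_{j=1}^m\frac{(\alpha a b_j/q,\alpha c_j;q)_\infty}{(\alpha a c_j/q,\alpha b_j;q)_\infty} =\sum_{n=0}^\infty\frac{(1-\alpha q^{2n})(\alpha,q/a;q)_n(a/q)^n}{(1-\alpha)(q,\alpha a;q)_n}\;{}_{m+2}\phi_{m+1}\left({q^{-n},\alpha q^n,\alpha c_1,\dots,\alpha c_m\atop \alpha b,\alpha b_1,\dots,\alpha b_m};q,q^{l+1}\right).$$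
   Context: Throughout $0<q<1$. Put $(x;q)_0=1$, $(x;q)_n=\prod_{k=0}^{n-1}(1-xq^k)$, $(x;q)_\infty=\prod_{k\ge0}(1-xq^k)$, and $(x_1,\dots,x_r;q)_n=(x_1;q)_n\cdots(x_r;q)_n$ for $n$ a nonnegative integer or $\infty$. The basic hypergeometric series is $${}_{r+1}\phi_r\left({a_1,\dots,a_{r+1}\atop b_1,\dots,b_r};q,z\right)=\sum_{k=0}^\infty\frac{(a_1,\dots,a_{r+1};q)_k}{(q,b_1,\dots,b_r;q)_k}z^k ;$$ when some $a_i=q^{-n}$ with $n\ge 0$ an integer, it is the finite sum over $0\le k\le n$. Removable singularities are read by continuity: $(q/a;q)_n(a/q)^n=q^{-n}\prod_{k=1}^n(a-q^k)$ also for $a=0$; and $(1-\alpha q^{2n})(\alpha;q)_n/(1-\alpha)$ means $1$ for $n=0$ and $(1-\alpha q^{2n})(\alpha q;q)_{n-1}$ for $n\ge1$, also for $\alpha=1$. *)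

(* Defs.v *)
From HB Require Import structures.
From mathcomp Require Import all_boot all_order all_algebra complex.
From mathcomp Require Import all_classical all_reals all_analysis.

Set Implicit Arguments.
Unset Strict Implicit.
Unset Printing Implicit Defensive.

Import Order.TTheory GRing.Theory Num.Theory.
Import numFieldNormedType.Exports.

Local Open Scope complex_scope.
Local Open Scope classical_set_scope.
Local Open Scope ring_scope.

Section QSeries.
Variable K : numFieldType.
Implicit Types (q x z a alpha : K) (s : seq K) (n k : nat).

Definition sums_to (u : nat -> K) (l : K) : Prop := series u @ \oo --> l.

(* (x; q)_n and (x_1, ..., x_r; q)_n *)
Definition qpoch x q n : K := \prod_(k < n) (1 - x * q ^+ k).

Definition qpochs s q n : K := \prod_(x <- s) qpoch x q n.

(* (x; q)_oo and (x_1, ..., x_r; q)_oo; for K = R[i] the limit exists when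
   `|q| < 1. *)
Definition qpochoo x q : K := limn (fun n => qpoch x q n).

Definition qpochsoo s q : K := \prod_(x <- s) qpochoo x q.

(* The value is meaningful only when the series converges; this covers the
   terminating case, see [qhyperN]. *)
Definition qhyper r (a : r.+1.-tuple K) (b : r.-tuple K) q z : K :=
  limn (series (fun k => qpochs a q k / qpochs (q :: b) q k * z ^+ k)).

(* (q/a; q)_n (a/q)^n, continued to a = 0; see [qpochdivE]. *)
Definition qpochdiv a q n : K := q ^- n * \prod_(1 <= k < n.+1) (a - q ^+ k).

(* (1 - alpha q^(2n)) (alpha; q)_n / (1 - alpha), continued to alpha = 1;
   see [verywellE]. *)
Definition verywell alpha q n : K :=
  if n is n'.+1 then (1 - alpha * q ^+ (2 * n)) * qpoch (alpha * q) q n' else 1.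

Lemma qpochdivE a q n : a != 0 -> q != 0 ->
  qpochdiv a q n = qpoch (q / a) q n * (a / q) ^+ n.
Proof.
move=> a0 q0; rewrite /qpochdiv big_add1 /= big_mkord expr_div_n mulrA mulrC.
congr (_ * _); rewrite -[n in a ^+ n]card_ord -prodr_const -big_split /=.
by apply: eq_bigr => i _; rewrite mulrBl mul1r mulrAC divfK// exprS.
Qed.

Lemma verywellE alpha q n : alpha != 1 ->
  verywell alpha q n =
  (1 - alpha * q ^+ (2 * n)) * qpoch alpha q n / (1 - alpha).
Proof.
move=> a1; have a1' : 1 - alpha != 0 by rewrite subr_eq0 eq_sym.
case: n => [|n] /=.
  by rewrite /qpoch big_ord0 muln0 expr0 !mulr1 divff.
rewrite /qpoch big_ord_recl expr0 mulr1 [(1 - alpha) * _]mulrC mulrA mulfK//.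
by congr (_ * _); apply: eq_bigr => i _; rewrite -mulrA -exprS.
Qed.

Lemma qpochN q n k : q != 0 -> (n < k)%N -> qpoch (q ^- n) q k = 0.
Proof.
move=> q0 nk; rewrite /qpoch (bigD1 (Ordinal nk)) //=.
by rewrite mulVf ?expf_neq0// subrr mul0r.
Qed.

Lemma qhyperN r (a : r.+1.-tuple K) (b : r.-tuple K) q z n :
    q != 0 -> q ^- n \in (a : seq K) ->
  qhyper a b q z =
  \sum_(k < n.+1) qpochs a q k / qpochs (q :: b) q k * z ^+ k.
Proof.
move=> q0 qa; apply: lim_near_cst; first exact: norm_hausdorff.
near=> N; have nN : (n < N)%N by near: N; exact: nbhs_infty_gt.
rewrite /series /= (big_cat_nat (n := n.+1)) //= big_mkord.
rewrite [X in _ + X]big_nat_cond [X in _ + X]big1 ?addr0 // => k /andP[/andP[nk _] _].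
by rewrite /qpochs (big_rem _ qa) /= qpochN// !mul0r.
Unshelve. all: by end_near. Qed.

End QSeries.

(* Main.v *)
Require Import Defs.
From HB Require Import structures.
From mathcomp Require Import all_boot all_order all_algebra complex.
From mathcomp Require Import all_classical all_reals all_analysis.
From mathcomp Require Import ring lra.

(** The right-hand side is a Newton interpolation series. Put [y = a / q]. The
    factor [(q/a; q)_n (a/q)^n] is [\prod_(j < n) (y - q^j)] and
    [(alpha a; q)_n] is [\prod_(1 <= j <= n) (1 - alpha q^j y)], so the partial
    sums are rational functions of [y] with prescribed poles, and all terms of
    index greater than [k] vanish at the node [y = q^k]. The left-hand side is,
    as a function of [y],

      F(y) = y^l \prod_(B, C) (B y; q)_oo (C; q)_oo / ((C y; q)_oo (B; q)_oo)

    where [(B, C)] runs through [(0, alpha q)], [(alpha b, 0)] and the pairs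
    [(alpha b_j, alpha c_j)], and it takes at [q^k] the value
    [q^(l k) \prod (C; q)_k / (B; q)_k]. The terminating hypergeometric series
    is, up to the explicit factors, the divided difference of these values at
    [1, q, ..., q^n] ([divdiff_lagrange], [prod_nodes], [term_divdiff]). So the
    theorem says that the interpolation series of [F] converges to [F].

    Since the nodes accumulate at [0] and [F] is analytic in a disc around [0]
    that contains [y], this convergence can be read off power series. Let [h_n] be
    the series left after [n] steps; one step multiplies it by [1 - s_n y],
    subtracts its value at the node [x_n] and divides by [y - x_n]. If
    [|h_n,i| <= M_n rho^i] for all [i], the next series satisfies the same bound
    with [M_(n+1) = M_n rho (1 + |s_n| / rho) / (1 - rho |x_n|)], while the
    factor in front of it is multiplied by [(y - x_n) / (1 - s_n y)]. As [x_n]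
    and [s_n] tend to [0], the remainder is eventually multiplied by about
    [rho |y|] at each step, and [rho] may be chosen with [rho |y| < 1]
    ([newton_cvg]).

    The parameters [alpha c_j] and [alpha q] may be large, so that the disc of
    analyticity, of radius [1 / max |C|], may leave out finitely many of the
    nodes. This is harmless: at such a node any value may be subtracted, because
    [1 / (y - x_n)] is then itself analytic in the disc ([growth_quot]).

    Finally [F] has a power series: each quotient [(B y; q)_oo / (C y; q)_oo] is
    given by the q-binomial theorem ([qbinomial]), and Cauchy products combine
    them ([qproduct_series]). The q-binomial series also yields the convergence
    of the infinite products and their non-vanishing ([qpoch_cvg],
    [qpochoo_neq0]). *)

Set Implicit Arguments.
Unset Strict Implicit.
Unset Printing Implicit Defensive.

Import Order.TTheory GRing.Theory Num.Theory.
Import numFieldNormedType.Exports.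

Local Open Scope complex_scope.
Local Open Scope classical_set_scope.
Local Open Scope ring_scope.

Local Notation nm := Normc.normc.

(** * Convergence of complex sequences and series *)

Section Convergence.
Variable K : numFieldType.

(** [R[i]] carries a topology only when it is viewed as a [numFieldType];
    stating convergence over an abstract field makes that view automatic. *)
Definition tends (u : nat -> K) (l : K) : Prop := u @ \oo --> l.

Definition psum (h : nat -> K) (y : K) : K :=
  limn (series (fun i => h i * y ^+ i)).

Lemma tends_lim u l : tends u l -> limn u = l.
Proof. by apply: cvg_lim; exact: norm_hausdorff. Qed.

Lemma tends_uniq u l l' : tends u l -> tends u l' -> l = l'.
Proof. by move=> /tends_lim <- /tends_lim <-. Qed.

Lemma tends_cst (l : K) : tends (fun=> l) l.
Proof. exact: cvg_cst. Qed.

Lemma tendsD u v l l' :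
  tends u l -> tends v l' -> tends (fun n => u n + v n) (l + l').
Proof. exact: cvgD. Qed.

Lemma tendsB u v l l' :
  tends u l -> tends v l' -> tends (fun n => u n - v n) (l - l').
Proof. exact: cvgB. Qed.

Lemma tendsM u v l l' :
  tends u l -> tends v l' -> tends (fun n => u n * v n) (l * l').
Proof. exact: cvgM. Qed.

Lemma tendsV u l : l != 0 -> tends u l -> tends (fun n => (u n)^-1) l^-1.
Proof. by move=> l0; apply: cvgV. Qed.

Lemma tendsS u l : tends (fun n => u n.+1) l <-> tends u l.
Proof. by split; rewrite /tends cvg_shiftS. Qed.

Lemma eq_tends u v l : u =1 v -> tends u l -> tends v l.
Proof. by move=> /funext ->. Qed.

Lemma eq_psum (h g : nat -> K) y z :
  (forall i, h i * y ^+ i = g i * z ^+ i) -> psum h y = psum g z.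
Proof. by move=> /funext hg; rewrite /psum hg. Qed.

End Convergence.

Arguments tends_cst {K} l.

Section Modulus.
Variable R : realType.
Implicit Types (z w : R[i]).

Lemma nmE z : `|z| = (nm z)%:C.
Proof. by case: z. Qed.

Lemma nm_ge0 z : 0 <= nm z.
Proof. by case: z => x y; apply: sqrtr_ge0. Qed.

Lemma nm0 : nm (0 : R[i]) = 0. Proof. exact: Normc.normc0. Qed.

Lemma nm1 : nm (1 : R[i]) = 1. Proof. exact: Normc.normc1. Qed.

Lemma nmM z w : nm (z * w) = nm z * nm w.
Proof. exact: Normc.normcM. Qed.

Lemma nmV z : nm z^-1 = (nm z)^-1.
Proof. exact: Normc.normcV. Qed.

Lemma nmX z n : nm (z ^+ n) = nm z ^+ n.
Proof. by elim: n => [|n IH]; rewrite ?expr0 ?nm1// !exprS nmM IH. Qed.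

Lemma nmN z : nm (- z) = nm z.
Proof. exact: normcN. Qed.

Lemma nmD z w : nm (z + w) <= nm z + nm w.
Proof. exact: le_normcD. Qed.

Lemma nmB z w : nm (z - w) <= nm z + nm w.
Proof. by rewrite -(nmN w) nmD. Qed.

Lemma nm_lb z w : nm z - nm w <= nm (z - w).
Proof. by rewrite lerBlDr -{1}(subrK w z) nmD. Qed.

Lemma nm_real (x : R) : nm x%:C = `|x|.
Proof. by rewrite /= expr0n /= addr0 sqrtr_sqr. Qed.

Lemma nm_eq0 z : (nm z == 0) = (z == 0).
Proof.
apply/eqP/eqP => [|->]; last exact: nm0.
exact: Normc.eq0_normc.
Qed.

Lemma nm_gt0 z : (0 < nm z) = (z != 0).
Proof. by rewrite lt_def nm_ge0 andbT nm_eq0. Qed.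

Lemma nm_lt1 z : (`|z| < 1) = (nm z < 1).
Proof. by rewrite nmE -ltcR. Qed.

Lemma nm_sum (I : Type) (r : seq I) (P : pred I) (F : I -> R[i]) :
  nm (\sum_(i <- r | P i) F i) <= \sum_(i <- r | P i) nm (F i).
Proof.
elim/big_ind2: _ => [|x a y b xa yb|//]; first by rewrite nm0.
by rewrite (le_trans (nmD _ _))// lerD.
Qed.

Lemma nm_prod (I : Type) (r : seq I) (P : pred I) (F : I -> R[i]) :
  nm (\prod_(i <- r | P i) F i) = \prod_(i <- r | P i) nm (F i).
Proof. by elim/big_ind2: _ => [|x a y b <- <-|//]; rewrite ?nm1 ?nmM. Qed.


Lemma tends_nmP (u : nat -> R[i]) (l : R[i]) :
  tends u l <-> (fun n => nm (l - u n)) @ \oo --> (0 : R).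
Proof.
split=> [/cvgrPdist_lt ul|/cvgrPdist_lt ul].
  apply/cvgrPdist_lt => e e0; have := ul e%:C.
  rewrite ltcR => /(_ e0); apply: filterS => n; rewrite nmE ltcR.
  by rewrite sub0r normrN ger0_norm// nm_ge0.
apply/cvgrPdist_lt => -[e e']; rewrite ltcE /= => /andP[/eqP -> e0].
have := ul e e0; apply: filterS => n; rewrite nmE.
by rewrite sub0r normrN ger0_norm ?nm_ge0// -ltcR.
Qed.

Lemma tends_nm_le (u : nat -> R[i]) (l : R[i]) (v : nat -> R) :
  (\forall n \near \oo, nm (l - u n) <= v n) -> v @ \oo --> (0 : R) ->
  tends u l.
Proof.
move=> uv v0; apply/tends_nmP.
apply: (@squeeze_cvgr _ _ _ _ (fun=> 0) v) => //; last exact: cvg_cst.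
by apply: filterS uv => n ->; rewrite nm_ge0.
Qed.

Lemma tends_nm (u : nat -> R[i]) (l : R[i]) :
  tends u l -> (fun n => nm (u n)) @ \oo --> nm l.
Proof.
move=> /tends_nmP ul; apply/cvgrPdist_le => e e0.
have /cvgrPdist_le/(_ e e0) := ul; apply: filterS => n.
rewrite sub0r normrN ger0_norm ?nm_ge0//; apply: le_trans.
rewrite ler_norml nm_lb andbT lerNl opprB.
by rewrite -[leRHS]nmN opprB nm_lb.
Qed.

Lemma tends_nm_bound (u : nat -> R[i]) (l : R[i]) (v : R) :
  tends u l -> (\forall n \near \oo, nm (u n) <= v) -> nm l <= v.
Proof.
move=> /tends_nm ul uv; have <- := cvg_lim (@Rhausdorff _) ul.
by apply: limr_le => //; apply/cvg_ex; exists (nm l).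
Qed.
(** Completeness of the complex numbers enters only here, through the real and
    imaginary parts. *)
Lemma abs_cvg_series (u : nat -> R[i]) (v : nat -> R) :
  (forall n, nm (u n) <= v n) -> cvgn (series v) ->
  exists l, tends (series u) l.
Proof.
move=> uv cv.
have part (p : R[i] -> R) : (forall z, `|p z| <= nm z) ->
    cvgn (series (fun n => p (u n))).
  move=> pz; apply: normed_cvg; apply: series_le_cvg cv => n /=.
  - exact: normr_ge0.
  - exact: le_trans (nm_ge0 _) (uv n).
  - exact: le_trans (pz _) (uv n).
have re : cvgn (series (fun n => complex.Re (u n))).
  apply: part => -[x y] /=; rewrite -sqrtr_sqr ler_wsqrtr// lerDl.
  exact: sqr_ge0.
have im : cvgn (series (fun n => complex.Im (u n))).
  apply: part => -[x y] /=; rewrite -sqrtr_sqr ler_wsqrtr// lerDr.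
  exact: sqr_ge0.
move: re im => /cvg_ex[/= a ha] /cvg_ex[/= b hb].
exists (a +i* b).
have parts n : \sum_(0 <= k < n) u k = (\sum_(0 <= k < n) complex.Re (u k))
    +i* (\sum_(0 <= k < n) complex.Im (u k)).
  elim: n => [|n IH]; first by rewrite !big_nil.
  by rewrite !big_nat_recr//= IH; case: (u n).
apply: (@tends_nm_le _ _ (fun n => `|a - series (fun n => complex.Re (u n)) n|
   + `|b - series (fun n => complex.Im (u n)) n|)).
  near=> n; rewrite /series /= parts.
  rewrite -[leLHS]/(Num.sqrt (_ ^+ 2 + _ ^+ 2)).
  rewrite -(@ler_pXn2r _ 2) ?nnegrE ?sqrtr_ge0 ?addr_ge0//.
  rewrite sqr_sqrtr ?addr_ge0 ?sqr_ge0// [leRHS]sqrrD !real_normK ?num_real//.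
  rewrite addrAC -!addrA lerD// lerDl mulrn_wge0 // mulr_ge0//.
rewrite -[X in _ --> X]addr0.
by apply: cvgD; [move: ha|move: hb] => /cvgrPdist_lt h; apply/cvgrPdist_lt => e
  e0; have := h e e0; apply: filterS => n; rewrite sub0r normrN normr_id.
Unshelve. all: by end_near. Qed.

End Modulus.

(** * Coefficient bounds for power series *)

Section PowerSeries.
Variable R : realType.
Implicit Types (h g : nat -> R[i]) (x y z s v : R[i]) (r rho M : R).

Lemma ratio_test (u c : nat -> R) r rho :
  (forall n, 0 <= u n) -> 0 < rho -> r < rho -> c @ \oo --> r ->
  (\forall n \near \oo, u n.+1 <= c n * u n) ->
  exists M, forall n, u n <= M * rho ^+ n.
Proof.
move=> u0 rho0 rrho cr uc.
have [K _ hK] : \forall n \near \oo, u n.+1 <= rho * u n.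
  have cle : \forall n \near \oo, c n <= rho by apply: (cvgr_le _ cr).
  near=> n; apply: le_trans (_ : c n * u n <= _); first by near: n.
  by rewrite ler_wpM2r//; near: n.
(* This sum dominates [u i / rho ^+ i] for each of the indices [i <= K], where
   the ratio is not controlled. *)
exists (\sum_(i < K.+1) u i / rho ^+ i) => n.
have rn k : 0 < rho ^+ k by rewrite exprn_gt0.
have [nK|] := leqP n K.
  rewrite -ler_pdivrMr// (bigD1 (Ordinal (nK : n < K.+1)%N))//= lerDl.
  by apply: sumr_ge0 => i _; rewrite divr_ge0// ltW.
move=> /ltnW/subnK <-; elim: (n - K)%N => [|m IH].
  rewrite add0n -ler_pdivrMr// (bigD1 ord_max)//= lerDl.
  by apply: sumr_ge0 => i _; rewrite divr_ge0// ltW.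
rewrite addSn (le_trans (hK (m + K)%N _))//=; first by rewrite /= leq_addl.
by rewrite exprS mulrCA ler_pM2l.
Unshelve. all: by end_near. Qed.

Lemma sum_geo_le (t : R) m n : 0 <= t < 1 ->
  \sum_(m <= j < n) t ^+ j <= t ^+ m / (1 - t).
Proof.
move=> /andP[t0 t1]; have d0 : 0 < 1 - t by rewrite subr_gt0.
rewrite ler_pdivlMr//; have [mn|nm] := leqP m n; last first.
  by rewrite big_geq ?mul0r ?exprn_ge0// ltnW.
suff -> : (\sum_(m <= j < n) t ^+ j) * (1 - t) = t ^+ m - t ^+ n.
  by rewrite gerBl exprn_ge0.
rewrite -(subnK mn); elim: (n - m)%N => [|k IH].
  by rewrite add0n big_geq// mul0r subrr.
by rewrite addSn big_nat_recr ?leq_addl//= mulrDl IH exprS; ring.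
Qed.

(** Coefficients of a power series converging in the disc of radius [1 / r];
    asking for every larger rate, rather than for the rate [r] itself, makes
    the class stable under products and under division by [y - x]. *)
Definition growth r h :=
  forall rho, r < rho -> exists M, forall i, nm (h i) <= M * rho ^+ i.

Lemma growth_room r y : 0 <= r -> r * nm y < 1 ->
  exists2 rho, r < rho & rho * nm y < 1.
Proof.
move=> r0 ry; have y0 := nm_ge0 y; set Y := nm y in ry y0 *.
pose d := (1 - r * Y) / (2 * (1 + Y)).
have dE : d * (2 * (1 + Y)) = 1 - r * Y.
  by rewrite divfK//; apply: lt0r_neq0; lra.
have d0 : 0 < d by rewrite divr_gt0; lra.
by exists (r + d); nra.
Qed.

Lemma bound_ge0 h M rho : (forall i, nm (h i) <= M * rho ^+ i) -> 0 <= M.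
Proof.
by move=> /(_ 0); rewrite expr0 mulr1; apply: le_trans; exact: nm_ge0.
Qed.

Section Bounded.
Variables (h : nat -> R[i]) (M rho : R) (y : R[i]).
Hypotheses (rho0 : 0 <= rho) (hM : forall i, nm (h i) <= M * rho ^+ i).
Hypothesis rhoy : rho * nm y < 1.

Let t01 : 0 <= rho * nm y < 1.
Proof. by rewrite rhoy mulr_ge0// nm_ge0. Qed.

Lemma term_le i : nm (h i * y ^+ i) <= M * (rho * nm y) ^+ i.
Proof.
by rewrite nmM nmX exprMn mulrA ler_wpM2r// exprn_ge0// nm_ge0.
Qed.

Lemma bounded_psum : tends (series (fun i => h i * y ^+ i)) (psum h y).
Proof.
have [l hl] : exists l, tends (series (fun i => h i * y ^+ i)) l.
  apply: (abs_cvg_series term_le); apply: is_cvg_geometric_series.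
  by case/andP: t01 => t0 t1; rewrite ger0_norm.
by rewrite /psum (tends_lim hl).
Qed.

Lemma sum_term_le m n : nm (\sum_(m <= j < n) h j * y ^+ j) <=
  M * (rho * nm y) ^+ m / (1 - rho * nm y).
Proof.
rewrite (le_trans (nm_sum _ _ _))//.
apply: le_trans (_ : \sum_(m <= j < n) M * (rho * nm y) ^+ j <= _).
  by apply: ler_sum => j _; exact: term_le.
by rewrite -mulr_sumr -mulrA ler_wpM2l ?sum_geo_le//; exact: bound_ge0 hM.
Qed.

Lemma psum_tail n : nm (psum h y - \sum_(0 <= j < n) h j * y ^+ j) <=
  M * (rho * nm y) ^+ n / (1 - rho * nm y).
Proof.
apply: (tends_nm_bound (tendsB bounded_psum (tends_cst _))).
near=> N; have nN : (n <= N)%N by near: N; exact: nbhs_infty_ge.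
rewrite /series /= (@big_cat_nat _ _ _ n 0 N)//= addrAC subrr add0r.
exact: sum_term_le.
Unshelve. all: by end_near. Qed.

Lemma psum_le : nm (psum h y) <= M / (1 - rho * nm y).
Proof.
by have := psum_tail 0; rewrite big_nil// subr0 expr0 mulr1.
Qed.

End Bounded.

Lemma growth_psum r h y : 0 <= r -> growth r h -> r * nm y < 1 ->
  tends (series (fun i => h i * y ^+ i)) (psum h y).
Proof.
move=> r0 gh /(growth_room r0)[rho rrho rhoy].
have [M hM] := gh _ rrho; apply: bounded_psum hM rhoy.
exact: le_trans (ltW rrho).
Qed.

Lemma expr_tends0 (t : R) : 0 <= t < 1 -> (fun n => t ^+ n) @ \oo --> (0 : R).
Proof. by move=> /andP[t0 t1]; apply: cvg_expr; rewrite ger0_norm. Qed.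

Lemma tends_term0 r h y : 0 <= r -> growth r h -> r * nm y < 1 ->
  tends (fun i => h i * y ^+ i) 0.
Proof.
move=> r0 gh ry.
have t0 := growth_psum r0 gh ry.
have := tendsB (iffRL (tendsS _ _) t0) t0.
rewrite subrr; apply: eq_tends => n.
by rewrite /series /= big_nat_recr//= addrAC subrr add0r.
Qed.

(** Continuity of a power series at the origin, along a geometric sequence. *)
Lemma psum_at0 r h x z : 0 <= r -> growth r h -> nm x < 1 ->
  tends (fun n => psum h (x ^+ n * z)) (h 0%N).
Proof.
move=> r0 gh x1.
pose rho := r + 1; have [M hM] : exists M, forall i, nm (h i) <= M * rho ^+ i.
  by apply: gh; rewrite ltrDl.
have rho0 : 0 <= rho by rewrite addr_ge0.
have M0 := bound_ge0 hM.
have xn0 : (fun n => nm x ^+ n) @ \oo --> (0 : R).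
  by apply: expr_tends0; rewrite nm_ge0.
have v0 c : (fun n => c * nm x ^+ n) @ \oo --> (0 : R).
  by rewrite -(mulr0 c); apply: cvgM xn0; exact: cvg_cst.
apply: (@tends_nm_le _ _ _ (fun n => (2 * M * rho * nm z) * nm x ^+ n));
  last first.
  exact: v0.
have sm : \forall n \near \oo, rho * nm z * nm x ^+ n <= 2^-1.
  by apply: (cvgr_le _ (v0 (rho * nm z))); rewrite invr_gt0.
near=> n.
have tE : rho * nm (x ^+ n * z) = rho * nm z * nm x ^+ n.
  by rewrite nmM nmX mulrAC -mulrA.
have t2 : rho * nm (x ^+ n * z) <= 2^-1 by rewrite tE; near: n.
have t0 : 0 <= rho * nm (x ^+ n * z) by rewrite mulr_ge0// nm_ge0.
have t1 : rho * nm (x ^+ n * z) < 1 by apply: le_lt_trans t2 _; lra.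
have := psum_tail rho0 hM t1 1.
rewrite big_nat1 expr0 mulr1 expr1 -nmN opprB => /le_trans -> //.
rewrite ler_pdivrMr ?subr_gt0//.
have -> : 2 * M * rho * nm z * nm x ^+ n = 2 * M * (rho * nm (x ^+ n * z)).
  by rewrite tE !mulrA.
set t := rho * _ in t0 t1 t2 *.
have : 0 <= M * t by rewrite mulr_ge0.
by nra.
Unshelve. all: by end_near. Qed.

End PowerSeries.

(** * Products and quotients of power series *)

Section Coefficients.
Variable K : fieldType.
Implicit Types (a b h : nat -> K) (s v x y : K).

Definition mulX h i : K := if i is i'.+1 then h i' else 0.

(** Coefficients of [(1 - s y) h(y)]. *)
Definition mul1BX s h i : K := h i - s * mulX h i.

Definition cauchy_prod a b i : K := \sum_(j < i.+1) a j * b (i - j)%N.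

(** Coefficients of [(h(y) - v) / (y - x)], both when [v] is the value of [h]
    at [x] and when [x] lies outside the disc of convergence of [h]. *)
Definition quot x v h i : K := (v - \sum_(j < i.+1) h j * x ^+ j) / x ^+ i.+1.

Lemma series_mulX h y n :
  series (fun i => mulX h i * y ^+ i) n.+1 =
  y * series (fun i => h i * y ^+ i) n.
Proof.
rewrite /series /= big_nat_recl//= mul0r add0r mulr_sumr.
by apply: eq_bigr => i _; rewrite exprS mulrCA.
Qed.

Lemma quot0 x v h : quot x v h 0 = (v - h 0%N) / x.
Proof. by rewrite /quot big_ord1 expr0 mulr1 expr1. Qed.

Lemma quotS x v h i : x != 0 ->
  quot x v h i.+1 = (quot x v h i - h i.+1) / x.
Proof.
move=> x0; rewrite /quot big_ord_recr /= [x ^+ i.+2]exprS.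
by field; rewrite x0 expf_neq0.
Qed.

(** Multiplying back by [y - x] telescopes, up to a last term that tends to 0
    inside the disc. *)
Lemma series_quot x v h y n : x != 0 ->
  (y - x) * series (fun i => quot x v h i * y ^+ i) n.+1 =
  series (fun i => h i * y ^+ i) n.+1 - v + y * (quot x v h n * y ^+ n).
Proof.
move=> x0; rewrite /series /=; elim: n => [|n IH].
  by rewrite !big_nat1 quot0 expr0; field.
rewrite big_nat_recr//= mulrDr IH [in RHS]big_nat_recr//= quotS// exprS.
by field.
Qed.

Lemma series_cauchy_prod a b y n :
  series (fun i => cauchy_prod a b i * y ^+ i) n =
  \sum_(i < n) a i * y ^+ i * series (fun j => b j * y ^+ j) (n - i)%N.
Proof.
rewrite /series /=; elim: n => [|n IH]; first by rewrite big_nil big_ord0.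
rewrite big_nat_recr//= IH big_ord_recr/= subSnn big_nat1 mulr_suml.
rewrite big_ord_recr/= subnn addrA -big_split/=; congr (_ + _); last first.
  by rewrite expr0 mulr1 mulrAC.
apply: eq_bigr => i _; rewrite subSn 1?ltnW// big_nat_recr//= mulrDr.
congr (_ + _).
have -> : y ^+ n = y ^+ i * y ^+ (n - i) by rewrite -exprD subnKC// ltnW.
by rewrite -!mulrA; congr (_ * _); rewrite mulrCA.
Qed.

End Coefficients.

Section Operations.
Variable R : realType.
Implicit Types (a b h : nat -> R[i]) (x y s v : R[i]) (r rho M : R).

Lemma mul1BX_bound h s M rho : 0 < rho ->
  (forall i, nm (h i) <= M * rho ^+ i) ->
  forall i, nm (mul1BX s h i) <= M * (1 + nm s / rho) * rho ^+ i.
Proof.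
move=> rho0 hM i; rewrite (le_trans (nmB _ _))// nmM mulrDr mulr1 mulrDl lerD//.
have M0 := bound_ge0 hM; have s0 := nm_ge0 s.
case: i => [|i].
  by rewrite -[mulX h 0]/(0 : R[i]) nm0 mulr0 !mulr_ge0 ?invr_ge0 ?expr0// ltW.
apply: le_trans (ler_wpM2l s0 (hM i)) _.
rewrite exprS le_eqVlt; apply/orP; left; apply/eqP.
by field; rewrite lt0r_neq0.
Qed.

Lemma growth_mul1BX r h s : 0 <= r -> growth r h -> growth r (mul1BX s h).
Proof.
move=> r0 gh rho rrho; have [M hM] := gh _ rrho; exists (M * (1 + nm s / rho)).
exact: (mul1BX_bound s (le_lt_trans r0 rrho) hM).
Qed.

Lemma growth_mulX r h : 0 <= r -> growth r h -> growth r (mulX h).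
Proof.
move=> r0 gh rho rrho; have [M hM] := gh _ rrho.
have rho0 : 0 < rho := le_lt_trans r0 rrho.
exists (M / rho) => -[|i].
  rewrite -[mulX h 0]/(0 : R[i]) nm0 expr0 mulr1 divr_ge0 ?(bound_ge0 hM)//.
  exact: ltW.
by rewrite exprS mulrA divfK ?gt_eqF//; exact: hM.
Qed.

Lemma psum_mulX r h y : 0 <= r -> growth r h -> r * nm y < 1 ->
  psum (mulX h) y = y * psum h y.
Proof.
move=> r0 gh ry; apply: tends_lim; apply/tendsS.
apply: eq_tends (fun n => esym (series_mulX h y n)) _.
exact: tendsM (tends_cst y) (growth_psum r0 gh ry).
Qed.

Lemma psum_mul1BX r h s y : 0 <= r -> growth r h -> r * nm y < 1 ->
  psum (mul1BX s h) y = (1 - s * y) * psum h y.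
Proof.
move=> r0 gh ry; apply: tends_lim.
have := growth_psum r0 (growth_mulX r0 gh) ry.
rewrite (psum_mulX r0 gh ry) => /(tendsM (tends_cst s)).
move=> /(tendsB (growth_psum r0 gh ry)); rewrite mulrBl mul1r -mulrA.
apply: eq_tends => n; rewrite /series /= mulr_sumr -sumrB.
by apply: eq_bigr => i _; rewrite mulrBl mulrA.
Qed.

(** Two bounds with rates [r1 < r2] leave a geometric factor in [r1 / r2], which
   keeps the number of terms of the convolution out of the estimate. *)
Lemma cauchy_prod_sum_le (u v : nat -> R) M1 M2 r1 r2 n : 0 <= r1 -> r1 < r2 ->
  0 <= M1 -> 0 <= M2 ->
  (forall i, 0 <= u i <= M1 * r1 ^+ i) ->
  (forall i, 0 <= v i <= M2 * r2 ^+ i) ->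
  \sum_(i < n.+1) u i * v (n - i)%N <= M1 * M2 / (1 - r1 / r2) * r2 ^+ n.
Proof.
move=> r10 r12 M10 M20 hu hv; have r20 : 0 < r2 by exact: le_lt_trans r12.
have t01 : 0 <= r1 / r2 < 1 by rewrite divr_ge0 ?ltr_pdivrMr ?mul1r// ltW.
apply: le_trans (_ : \sum_(i < n.+1) M1 * M2 * r2 ^+ n * (r1 / r2) ^+ i <= _).
  apply: ler_sum => i _.
  case/andP: (hu i) => u0 u1; case/andP: (hv (n - i)%N) => v0 v1.
  apply: le_trans (ler_pM u0 v0 u1 v1) _.
  rewrite le_eqVlt; apply/orP; left; apply/eqP.
  have -> : r2 ^+ n = r2 ^+ i * r2 ^+ (n - i).
    by rewrite -exprD subnKC// -ltnS.
  rewrite expr_div_n.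
  by field; rewrite expf_neq0// gt_eqF.
rewrite -mulr_sumr -(big_mkord xpredT (fun i => (r1 / r2) ^+ i)).
rewrite [leRHS]mulrAC ler_wpM2l//.
  by rewrite !mulr_ge0// exprn_ge0// ltW.
by have := sum_geo_le 0 n.+1 t01; rewrite expr0 mul1r.
Qed.

Lemma growth_cauchy_prod r a b : 0 <= r -> growth r a -> growth r b ->
  growth r (cauchy_prod a b).
Proof.
move=> r0 ga gb rho rrho; pose rho1 := (r + rho) / 2.
have r1 : r < rho1 by rewrite /rho1; lra.
have r12 : rho1 < rho by rewrite /rho1; lra.
have r10 : 0 <= rho1 by lra.
have [M1 h1] := ga _ r1; have [M2 h2] := gb _ rrho.
exists (M1 * M2 / (1 - rho1 / rho)) => i.
apply: le_trans (nm_sum _ _ _) _; under eq_bigr do rewrite nmM.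
apply: (cauchy_prod_sum_le (u := fun j => nm (a j))
                           (v := fun j => nm (b j))) => //.
- exact: bound_ge0 h1.
- exact: bound_ge0 h2.
- by move=> j; rewrite nm_ge0 h1.
- by move=> j; rewrite nm_ge0 h2.
Qed.

Lemma psum_cauchy_prod r a b y : 0 <= r -> growth r a -> growth r b ->
  r * nm y < 1 -> psum (cauchy_prod a b) y = psum a y * psum b y.
Proof.
move=> r0 ga gb ry; have [rho rrho rhoy] := growth_room r0 ry.
have rho0 : 0 <= rho by exact: le_trans (ltW rrho).
have [M1 h1] := ga _ rrho; have [M2 h2] := gb _ rrho.
set t := rho * nm y in rhoy.
have t0 : 0 <= t by rewrite mulr_ge0// nm_ge0.
pose t' := (t + 1) / 2.
have tt' : t < t' by rewrite /t'; lra.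
have t'1 : 0 <= t' < 1 by rewrite /t'; apply/andP; split; lra.
have M20 := bound_ge0 h2.
have M2' : 0 <= M2 / (1 - t) by rewrite divr_ge0// subr_ge0 ltW.
have tail0 : tends (fun n => series (fun i => a i * y ^+ i) n * psum b y -
    series (fun i => cauchy_prod a b i * y ^+ i) n) 0.
  pose c := M1 * (M2 / (1 - t)) / (1 - t / t').
  apply: (@tends_nm_le _ _ _ (fun n => c * t' ^+ n)); last first.
    by rewrite -(mulr0 c); apply: cvgM; [exact: cvg_cst|exact: expr_tends0].
  near=> n; rewrite sub0r nmN series_cauchy_prod /series /= big_mkord.
  rewrite mulr_suml -sumrB.
  under eq_bigr do rewrite -mulrBr.
  apply: le_trans (nm_sum _ _ _) _.
  pose u i := nm (a i * y ^+ i).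
  pose v k := nm (psum b y - series (fun j => b j * y ^+ j) k).
  apply: le_trans (_ : \sum_(i < n.+1) u i * v (n - i)%N <= _).
    rewrite big_ord_recr /= ler_wpDr ?mulr_ge0 ?nm_ge0//.
    by apply: ler_sum => i _; rewrite nmM.
  apply: cauchy_prod_sum_le => //.
  - exact: bound_ge0 h1.
  - by move=> i; rewrite nm_ge0 term_le.
  - move=> i; rewrite nm_ge0 /=; apply: le_trans (psum_tail rho0 h2 rhoy _) _.
    by rewrite mulrAC ler_wpM2l// lerXn2r ?nnegrE// ltW// (le_lt_trans t0).
apply: tends_lim.
have := tendsB (tendsM (growth_psum r0 ga ry) (tends_cst (psum b y))) tail0.
by rewrite subr0; apply: eq_tends => n; rewrite opprB addrC subrK.
Unshelve. all: by end_near. Qed.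

(** The coefficients of the quotient are tails of the series at [x], divided by
    powers of [x]; at a rate [rho] with [rho |x| < 1] the bound keeps this rate,
    which makes the estimate iterable. *)
Lemma quot_bound_in h M rho x v : 0 <= rho ->
  (forall i, nm (h i) <= M * rho ^+ i) -> x != 0 -> rho * nm x < 1 ->
  psum h x = v ->
  forall i, nm (quot x v h i) <= M * (rho / (1 - rho * nm x)) * rho ^+ i.
Proof.
move=> rho0 hM x0 rx <- i; have nx : 0 < nm x by rewrite nm_gt0.
rewrite /quot -(big_mkord xpredT (fun j => h j * x ^+ j)) nmM nmV nmX.
rewrite ler_pdivrMr ?exprn_gt0//; apply: le_trans (psum_tail rho0 hM rx _) _.
rewrite exprMn le_eqVlt; apply/orP; left; apply/eqP.
by rewrite !exprS; field; rewrite subr_eq0 gt_eqF.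
Qed.

(** Here [1 / (y - x)] has itself coefficients growing slower than [rho ^+ i],
    so the quotient is analytic whatever the value [v]. *)
Lemma quot_bound_out h M rho x v : 0 < rho ->
  (forall i, nm (h i) <= M * rho ^+ i) -> x != 0 -> 1 < rho * nm x ->
  exists M', forall i, nm (quot x v h i) <= M' * rho ^+ i.
Proof.
move=> rho0 hM x0 rx; have nx : 0 < nm x by rewrite nm_gt0.
have M0 := bound_ge0 hM.
(* [A] absorbs the initial coefficient; [B] solves
   [B + M rho = B rho |x|], which makes the recursion of [quotS] close up. *)
pose A := (nm v + M) / nm x; pose B := M * rho / (rho * nm x - 1).
have A0 : 0 <= A by rewrite divr_ge0 ?addr_ge0 ?nm_ge0// ltW.
have B0 : 0 <= B by rewrite divr_ge0 ?mulr_ge0 ?subr_ge0// ltW.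
have BE : B * (rho * nm x - 1) = M * rho.
  by rewrite divfK// subr_eq0 gt_eqF.
exists (A + B); elim=> [|i IH].
  rewrite quot0 expr0 mulr1 nmM nmV (le_trans (_ : _ <= A)) ?lerDl//.
  rewrite ler_pM2r ?invr_gt0// (le_trans (nmB _ _))// lerD2l.
  by have := hM 0; rewrite expr0 mulr1.
rewrite quotS// nmM nmV ler_pdivrMr// (le_trans (nmB _ _))//.
apply: le_trans (lerD IH (hM i.+1)) _.
rewrite exprS -subr_ge0.
have -> : (A + B) * (rho * rho ^+ i) * nm x -
  ((A + B) * rho ^+ i + M * (rho * rho ^+ i)) =
  (A * (rho * nm x - 1) + (B * (rho * nm x - 1) - M * rho)) * rho ^+ i by ring.
rewrite BE subrr addr0 mulr_ge0 ?exprn_ge0 ?(ltW rho0)// mulr_ge0//.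
by rewrite subr_ge0 ltW.
Qed.

Lemma growth_quot r h x v : 0 <= r -> growth r h -> x != 0 ->
  (r * nm x < 1 -> psum h x = v) -> growth r (quot x v h).
Proof.
move=> r0 gh x0 hx rho rrho; have nx : 0 < nm x by rewrite nm_gt0.
have rho0 : 0 < rho := le_lt_trans r0 rrho.
have [rx|rx] := ltP (r * nm x) 1; last first.
  have [M hM] := gh _ rrho; apply: quot_bound_out hM x0 _ => //.
  by apply: le_lt_trans rx _; rewrite ltr_pM2r.
have [rho1 r1 x1] := growth_room r0 rx.
(* A bound at a smaller rate is stronger, so [rho] may be lowered until
   [rho |x| < 1]. *)
pose rho' := Num.min rho1 rho.
have r' : r < rho' by rewrite lt_min r1.
have r'0 : 0 < rho' by exact: le_lt_trans r'.
have [M hM] := gh _ r'.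
have x' : rho' * nm x < 1.
  by apply: le_lt_trans x1; rewrite ler_pM2r// ge_min lexx.
exists (M * (rho' / (1 - rho' * nm x))) => i.
apply: le_trans (quot_bound_in (ltW r'0) hM x0 x' (hx rx) i) _.
rewrite ler_wpM2l//; last first.
  by rewrite lerXn2r ?nnegrE ?(ltW r'0) ?(ltW rho0)// ge_min lexx orbT.
by rewrite mulr_ge0 ?(bound_ge0 hM)// divr_ge0 ?subr_ge0 ?(ltW r'0) ?(ltW x').
Qed.

Lemma psum_quot r h x v y : 0 <= r -> growth r h -> x != 0 ->
  (r * nm x < 1 -> psum h x = v) -> r * nm y < 1 ->
  (y - x) * psum (quot x v h) y = psum h y - v.
Proof.
move=> r0 gh x0 hx ry; have gq := growth_quot r0 gh x0 hx.
have ql := growth_psum r0 gq ry.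
apply: tends_uniq (tendsM (tends_cst (y - x)) (iffRL (tendsS _ _) ql)) _.
apply: eq_tends (fun n => esym (series_quot v h y n x0)) _.
rewrite -[X in tends _ X]addr0 -(mulr0 y); apply: tendsD.
  apply: tendsB (tends_cst v).
  by apply/(tendsS (series (fun i => h i * y ^+ i))); exact: growth_psum gh ry.
exact: tendsM (tends_cst y) (tends_term0 r0 gq ry).
Qed.

End Operations.

(** * Rational Newton interpolation *)

Section DividedDifferences.
Variable K : fieldType.
Variables (x s d : nat -> K).

(** Table of divided differences of the values [d] at the nodes [x], for
    interpolation by rational functions with poles at the points [1 / s n]:
    [divdiff n k] is the value at [x k] of the function left after the first [n]
    nodes have been removed. *)
Fixpoint divdiff n k : K :=
  if n is n'.+1 then
    ((1 - s n' * x k) * divdiff n' k - (1 - s n' * x n') * divdiff n' n')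
      / (x k - x n')
  else d k.

Hypothesis xinj : injective x.

Let xne i j : i != j -> x i - x j != 0.
Proof. by move=> ij; rewrite subr_eq0; apply: contra_neq ij => /xinj. Qed.

(** Partial fractions in closed form. The inductive step rests on the identity
    [(1 - s u) (w - v) - (1 - s v) (w - u) = (u - v) (1 - s w)] with
    [u = x k], [v = x n], [w = x j]. *)
Lemma divdiff_lagrange n k : (n <= k)%N ->
  divdiff n k =
  \sum_(j < n) (\prod_(i < n) (1 - s i * x j)) * d j
     / ((\prod_(i < n | i != j :> nat) (x j - x i)) * (x j - x k))
  + (\prod_(i < n) (1 - s i * x k)) * d k / \prod_(i < n) (x k - x i).
Proof.
elim: n k => [|n IH] k nk.
  by rewrite !big_ord0 mul1r divr1 add0r.
rewrite /= (IH k (ltnW nk)) (IH n (leqnn n)) big_ord_recr /=.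
have kn : x k - x n != 0 by rewrite xne// gtn_eqF.
have nk' : x n - x k != 0 by rewrite xne// ltn_eqF.
have Pk : \prod_(i < n) (x k - x i) != 0.
  by apply/prodf_neq0 => i _; rewrite xne// gtn_eqF// (ltn_trans _ nk).
have Pn : \prod_(i < n) (x n - x i) != 0.
  by apply/prodf_neq0 => i _; rewrite xne// gtn_eqF.
have -> : \prod_(i < n.+1 | i != n :> nat) (x n - x i) =
    \prod_(i < n) (x n - x i).
  rewrite big_mkcond big_ord_recr /= eqxx mulr1; apply: eq_bigr => i _.
  by rewrite ltn_eqF.
(* The step acts separately on each term [j < n], on the term of [x k], and on
   the term of [x n], which becomes the new term [j = n]. *)
have E (F1 F2 F3 : 'I_n -> K) u v w w' :
  (forall j, ((1 - s n * x k) * F1 j - (1 - s n * x n) * F2 j) / (x k - x n) =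
     F3 j) ->
  ((1 - s n * x k) * u) / (x k - x n) = w ->
  - ((1 - s n * x n) * v) / (x k - x n) = w' ->
  ((1 - s n * x k) * (\sum_j F1 j + u) - (1 - s n * x n) * (\sum_j F2 j + v))
     / (x k - x n) = \sum_j F3 j + w' + w.
  move=> FE <- <-; under [in RHS]eq_bigr do rewrite -FE.
  rewrite -mulr_suml sumrB -!mulr_sumr; by field.
apply: E => [j||].
- have jn : x j - x n != 0 by rewrite xne// ltn_eqF.
  have jk : x j - x k != 0 by rewrite xne// ltn_eqF// (ltn_trans _ nk).
  have Pj : \prod_(i < n | i != j :> nat) (x j - x i) != 0.
    by apply/prodf_neq0 => i ij; rewrite xne// eq_sym.
  rewrite big_ord_recr /=.
  have -> : \prod_(i < n.+1 | i != j :> nat) (x j - x i) =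
    \prod_(i < n | i != j :> nat) (x j - x i) * (x j - x n).
    by rewrite big_mkcond big_ord_recr /= gtn_eqF// -big_mkcond.
  by field; rewrite kn jn jk Pj.
- by rewrite !big_ord_recr/=; field; rewrite kn Pk.
- by rewrite !big_ord_recr/=; field; rewrite kn nk' Pn.
Qed.

Lemma divdiff_diag n :
  divdiff n n = \sum_(j < n.+1) (\prod_(i < n) (1 - s i * x j)) * d j
     / \prod_(i < n.+1 | i != j :> nat) (x j - x i).
Proof.
rewrite divdiff_lagrange// big_ord_recr /=; congr (_ + _ / _).
  apply: eq_bigr => j _; congr (_ / _).
  by rewrite [in RHS]big_mkcond big_ord_recr /= gtn_eqF// -big_mkcond.
rewrite [in RHS]big_mkcond big_ord_recr /= eqxx mulr1; apply: eq_bigr => i _.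
by rewrite ltn_eqF.
Qed.

End DividedDifferences.

Section Interpolation.
Variable R : realType.
Variables (x s d h : nat -> R[i]) (r : R) (y : R[i]).

(** Power series of the functions whose values at the nodes form the rows of
    [divdiff], started from a series [h] which takes the values [d] at those
    nodes that lie in its disc of convergence. *)
Fixpoint remainder n : nat -> R[i] :=
  if n is n'.+1 then
    quot (x n') ((1 - s n' * x n') * divdiff x s d n' n')
      (mul1BX (s n') (remainder n'))
  else h.

Hypothesis xinj : injective x.
Hypothesis x_neq0 : forall n, x n != 0.
Hypothesis x_to0 : tends x 0.
Hypothesis s_to0 : tends s 0.
Hypothesis r_ge0 : 0 <= r.
Hypothesis gh : growth r h.
Hypothesis hd : forall k, r * nm (x k) < 1 -> psum h (x k) = d k.
Hypothesis ry : r * nm y < 1.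
Hypothesis sy : forall n, 1 - s n * y != 0.

Local Notation e := (divdiff x s d).

Lemma remainder_ok n : growth r (remainder n) /\
  forall k, (n <= k)%N -> r * nm (x k) < 1 -> psum (remainder n) (x k) = e n k.
Proof.
elim: n => [|n [gn IH]]; first by split=> // k _; exact: hd.
have gl := growth_mul1BX (s n) r_ge0 gn.
have v : r * nm (x n) < 1 -> psum (mul1BX (s n) (remainder n)) (x n) =
    (1 - s n * x n) * e n n.
  by move=> rx; rewrite (psum_mul1BX _ r_ge0 gn)// IH.
split=> [|k nk rk]; first exact: growth_quot.
have xkn : x k - x n != 0.
  by rewrite subr_eq0; apply: contraTneq nk => /xinj ->; rewrite ltnn.
apply: (mulfI xkn); rewrite (psum_quot r_ge0)//.
by rewrite (psum_mul1BX _ r_ge0 gn)// IH 1?ltnW//= [RHS]mulrC divfK.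
Qed.

Local Notation P n := (\prod_(j < n) (y - x j)).
Local Notation Q n := (\prod_(j < n) (1 - s j * y)).

Lemma newton_remainder n :
  series (fun n => (1 - s n * x n) * e n n * P n / Q n.+1) n
  + P n / Q n * psum (remainder n) y = psum h y.
Proof.
elim: n => [|n IH].
  by rewrite /series /= big_nil !big_ord0 divr1 mul1r add0r.
rewrite -[in RHS]IH seriesSr -addrA; congr (_ + _).
have [gn nv] := remainder_ok n; have gl := growth_mul1BX (s n) r_ge0 gn.
have v : r * nm (x n) < 1 -> psum (mul1BX (s n) (remainder n)) (x n) =
    (1 - s n * x n) * e n n.
  by move=> rx; rewrite (psum_mul1BX _ r_ge0 gn)// nv.
have := psum_quot r_ge0 gl (x_neq0 n) v ry; rewrite (psum_mul1BX _ r_ge0 gn)//.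
rewrite !big_ord_recr /=.
set H := psum _ _; set H' := psum _ _ => E.
have Q0 : Q n != 0 by apply/prodf_neq0 => j _.
rewrite -!mulrA.
transitivity
  (P n / Q n * ((1 - s n * x n) * e n n + (y - x n) * H) / (1 - s n * y)).
  by field; rewrite Q0 sy.
by rewrite E; field; rewrite Q0 sy.
Qed.

(** The remainder in [newton_remainder] tends to 0: from the index [N] on, where
    [rho |x n| < 1], its bound [u] is multiplied at each step by [c m], and
    [c m] tends to [rho |y| < 1]. *)
Theorem newton_cvg :
  tends (series (fun n => (1 - s n * x n) * e n n * P n / Q n.+1)) (psum h y).
Proof.
have [rho rrho rhoy] := growth_room r_ge0 ry.
have rho0 : 0 < rho := le_lt_trans r_ge0 rrho.
have nx0 : (fun n => nm (x n)) @ \oo --> (0 : R).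
  by rewrite -(nm0 R); exact: tends_nm.
have ns0 : (fun n => nm (s n)) @ \oo --> (0 : R).
  by rewrite -(nm0 R); exact: tends_nm.
have rx0 : (fun n => rho * nm (x n)) @ \oo --> (0 : R).
  by rewrite -(mulr0 rho); apply: cvgM nx0; exact: cvg_cst.
have [N _ hN] : \forall n \near \oo, rho * nm (x n) < 1.
  by apply: (cvgr_lt _ rx0).
have xN m : rho * nm (x (m + N)%N) < 1 by apply: hN; rewrite /= leq_addl.
have [M0 hM0] := (remainder_ok N).1 rho rrho.
pose kap n := (1 + nm (s n) / rho) * (rho / (1 - rho * nm (x n))).
pose M m := M0 * \prod_(j < m) kap (j + N)%N.
have hM m i : nm (remainder (m + N) i) <= M m * rho ^+ i.
  elim: m i => [|m IH] i; first by rewrite /M big_ord0 mulr1.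
  have [gn nv] := remainder_ok (m + N).
  rewrite /M big_ord_recr /= [M0 * _]mulrA [X in _ <= X * _]mulrA.
  apply: quot_bound_in (ltW rho0) (mul1BX_bound _ rho0 IH) (x_neq0 _)
    (xN m) _ i.
  rewrite (psum_mul1BX _ r_ge0 gn) ?nv//.
    apply: le_lt_trans (xN m); rewrite ler_wpM2r ?nm_ge0//; exact: ltW.
  apply: le_lt_trans (xN m); rewrite ler_wpM2r ?nm_ge0//; exact: ltW.
pose w n := nm (y - x n) / nm (1 - s n * y).
pose u m := \prod_(j < m + N) w j * M m.
pose c m := w (m + N)%N * kap (m + N)%N.
have kap0 m : 0 <= kap (m + N)%N.
  rewrite mulr_ge0 ?addr_ge0 ?divr_ge0 ?nm_ge0 ?subr_ge0 ?(ltW rho0)//.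
  exact: ltW.
have u0 m : 0 <= u m.
  rewrite !mulr_ge0 ?(bound_ge0 hM0)//; apply: prodr_ge0 => j _ //.
  by rewrite divr_ge0 ?nm_ge0.
have uS m : u m.+1 = c m * u m.
  by rewrite /u /M addSn !big_ord_recr /= /c; ring.
have cl : c @ \oo --> rho * nm y.
  have wl : w @ \oo --> nm y.
    rewrite -[X in _ --> X]divr1; apply: cvgM.
      rewrite -[y in nm y]subr0; apply: tends_nm.
      exact: tendsB (tends_cst y) x_to0.
    apply: cvgV; first exact: oner_neq0.
    rewrite -(nm1 R) -[1 in X in _ --> X]subr0 -(mul0r y); apply: tends_nm.
    by apply: tendsB (tends_cst _) _; apply: tendsM s_to0 (tends_cst y).
  have kl : kap @ \oo --> rho.
    have -> : rho = (1 + 0 / rho) * (rho / (1 - 0)).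
      by rewrite mul0r addr0 mul1r subr0 divr1.
    apply: cvgM.
      by apply: cvgD; [exact: cvg_cst|apply: cvgM ns0 _; exact: cvg_cst].
    apply: cvgM; first exact: cvg_cst.
    apply: cvgV; first by rewrite subr0 oner_neq0.
    by apply: cvgB rx0; exact: cvg_cst.
  rewrite mulrC.
  have := cvgM wl kl; rewrite -(cvg_shiftn N).
  exact.
pose tau := (rho * nm y + 1) / 2.
have t0 : 0 <= rho * nm y by rewrite mulr_ge0 ?nm_ge0// ltW.
have tau1 : 0 < tau < 1 by rewrite /tau; apply/andP; split; lra.
have [A hA] : exists A, forall m, u m <= A * tau ^+ m.
  apply: (@ratio_test _ u c (rho * nm y)) => //.
  - by case/andP: tau1.
  - by rewrite /tau; lra.
  - by near=> m; rewrite uS.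
pose B := A / (1 - rho * nm y).
rewrite /tends -(cvg_shiftn N).
apply: (@tends_nm_le _ _ _ (fun m => B * tau ^+ m)); last first.
  rewrite -(mulr0 B); apply: cvgM; [exact: cvg_cst|apply: expr_tends0].
  by case/andP: tau1 => /ltW -> ->.
near=> m.
rewrite -(newton_remainder (m + N)) addrAC subrr add0r nmM.
apply: le_trans (_ : _ <= u m / (1 - rho * nm y)) _; last first.
  by rewrite /B [leRHS]mulrAC ler_wpM2r ?hA// invr_ge0 subr_ge0 ltW.
rewrite /u -mulrA; apply: ler_pM; rewrite ?nm_ge0//; last first.
  exact: psum_le (ltW rho0) (hM m) rhoy.
rewrite nmM nmV !nm_prod -prodfV -big_split /=.
exact: lexx.
Unshelve. all: by end_near. Qed.

End Interpolation.

(** * Finite q-shifted factorials *)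

Section QShifted.
Variable K : numFieldType.
Implicit Types (x q alpha : K).

Lemma qpochS x q n : qpoch x q n.+1 = qpoch x q n * (1 - x * q ^+ n).
Proof. by rewrite /qpoch big_ord_recr. Qed.

Lemma qpochD x q m n :
  qpoch x q (m + n) = qpoch x q m * qpoch (x * q ^+ m) q n.
Proof.
elim: n => [|n IH]; first by rewrite addn0 [qpoch _ _ 0]big_ord0 mulr1.
by rewrite addnS !qpochS IH -[x * _ * _]mulrA -exprD mulrA.
Qed.

Lemma qpoch0 q n : qpoch 0 q n = 1.
Proof. by rewrite /qpoch big1// => i _; rewrite mul0r subr0. Qed.

Lemma qpochoo0 q : qpochoo 0 q = 1.
Proof.
apply: tends_lim; apply: eq_tends (fun n => esym (qpoch0 q n)) _.
exact: tends_cst.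
Qed.

(** After reversing two of the products the factors match in pairs. *)
Lemma qpochN_prod q m k : q != 0 ->
  qpoch (q ^- (m + k)) q k * (q ^+ m.+1) ^+ k *
    \prod_(i < k) (q ^+ k - q ^+ i) =
  qpoch q q k * qpoch (q ^+ m.+1) q k.
Proof.
move=> q0; rewrite /qpoch [\prod_(i < k) (_ - q ^+ i)](reindex_inj rev_ord_inj).
rewrite [\prod_(i < k) (1 - q ^+ m.+1 * _)](reindex_inj rev_ord_inj) /=.
have -> : (q ^+ m.+1) ^+ k = \prod_(i < k) q ^+ m.+1.
  by rewrite prodr_const card_ord.
rewrite -!big_split /=.
apply: eq_bigr => -[i ik] _ /=.
have [j kE] : exists j, (k = j + i.+1)%N by exists (k - i.+1)%N; rewrite subnK.
rewrite kE !addnK addnA -exprD -!exprS.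
have E : q ^+ (m + j + i.+1) = q ^+ (m.+1 + j) * q ^+ i.
  by rewrite -exprD !addSn addnS.
have E' : q ^+ (j + i.+1) = q ^+ i.+1 * q ^+ j by rewrite -exprD addnC.
rewrite E' E exprD !exprS. 
by field; rewrite !expf_neq0.
Qed.

(** The denominators of the divided differences at the nodes [q ^+ i]; this is
    where the factor [(q^-n; q)_k] of the hypergeometric series comes from. *)
Lemma prod_nodes q n k : q != 0 -> (k <= n)%N ->
  qpoch (q ^- n) q k * q ^+ k *
    \prod_(i < n.+1 | i != k :> nat) (q ^+ k - q ^+ i) =
  qpoch q q k * qpoch q q n.
Proof.
move=> q0 kn; rewrite -(subnK kn); move: (n - k)%N => m.
have -> : \prod_(i < (m + k).+1 | i != k :> nat) (q ^+ k - q ^+ i) =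
    (q ^+ k) ^+ m * qpoch q q m * \prod_(i < k) (q ^+ k - q ^+ i).
  elim: m => [|m IH].
    rewrite add0n expr0 mul1r [qpoch _ _ 0]big_ord0 mul1r big_mkcond.
    rewrite big_ord_recr /= eqxx mulr1; apply: eq_bigr => i _.
    by rewrite ltn_eqF.
  rewrite big_mkcond addSn big_ord_recr /= -big_mkcond IH.
  rewrite gtn_eqF ?ltnS ?leq_addl// qpochS [q ^+ (m + k).+1]exprS exprD.
  by rewrite [(q ^+ k) ^+ m.+1]exprS /=; ring.
have := qpochN_prod m k q0; rewrite qpochD -exprS.
have -> : (q ^+ m.+1) ^+ k = q ^+ k * (q ^+ k) ^+ m.
  by rewrite -exprM mulSn exprD -exprM mulnC.
by move=> E; rewrite [RHS]mulrCA -E; ring.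
Qed.

(** The poles of the interpolating functions are the points
    [1 / pole q alpha n]. The first factor has no pole, because the denominators
    are [(alpha q y; q)_n] and not [(alpha y; q)_n]; this choice also covers
    [alpha = 1] and [alpha y = 1]. *)
Definition pole q alpha n : K := if n == 0%N then 0 else alpha * q ^+ n.

(** Both sides are products of consecutive factors [1 - alpha q^i]; this
    accounts for the very-well-poised part of the summand. *)
Lemma verywell_shift alpha q n k : (k <= n)%N ->
  verywell alpha q n * qpoch (alpha * q ^+ n) q k =
  (1 - pole q alpha n * q ^+ n) *
  (\prod_(i < n) (1 - pole q alpha i * q ^+ k)) * qpoch (alpha * q) q k.
Proof.
rewrite /pole.
case: n => [|n].
  rewrite leqn0 => /eqP ->.
  by rewrite big_ord0 ![qpoch _ _ 0]big_ord0 mul0r subr0 !mulr1.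
move=> _; rewrite big_ord_recl /= mul0r subr0 mul1r -!mulrA.
congr (_ * _); first by rewrite mulrA mul2n -addnn exprD !mulrA.
rewrite exprS [in LHS]mulrA -qpochD addnC qpochD mulrC; congr (_ * _).
by apply: eq_bigr => i _; rewrite /= exprS; ring.
Qed.

End QShifted.

(** * The q-binomial theorem and infinite products *)

Section QBinomial.
Variable R : realType.
Variable q : R[i].
Hypothesis q1 : nm q < 1.
Implicit Types (B C x y z : R[i]).

(** Coefficients of [(B y; q)_oo / (C y; q)_oo]; writing the q-binomial
    coefficients in this homogeneous form covers [C = 0]. *)
Definition qbin B C i : R[i] :=
  \prod_(j < i) ((C - B * q ^+ j) / (1 - q ^+ j.+1)).

Lemma one_sub_neq0 z : nm z < 1 -> 1 - z != 0.
Proof.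
by move=> z1; rewrite subr_eq0; apply: contraTneq z1 => <-; rewrite nm1 ltxx.
Qed.

Lemma nm_qX z n : nm z < 1 -> nm (z * q ^+ n) < 1.
Proof.
move=> z1; rewrite nmM nmX; apply: le_lt_trans z1.
by rewrite ler_piMr ?nm_ge0// exprn_ile1 ?nm_ge0// ltW.
Qed.

Lemma qpoch_neq0 z n : nm z < 1 -> qpoch z q n != 0.
Proof. by move=> z1; apply/prodf_neq0 => i _; rewrite one_sub_neq0 ?nm_qX. Qed.

Lemma qX_to0 : tends (fun n => q ^+ n) 0.
Proof.
apply: (@tends_nm_le _ _ _ (fun n => nm q ^+ n)).
  by near=> n; rewrite sub0r nmN nmX.
by apply: expr_tends0; rewrite nm_ge0.
Unshelve. all: by end_near. Qed.

Lemma one_sub_qS_neq0 n : 1 - q ^+ n.+1 != 0.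
Proof. by rewrite exprS one_sub_neq0// nm_qX. Qed.

Lemma qbin_growth B C : growth (nm C) (qbin B C).
Proof.
move=> rho Crho.
have rho0 : 0 < rho by exact: le_lt_trans (nm_ge0 C) Crho.
pose c i := nm (C - B * q ^+ i) / nm (1 - q ^+ i.+1).
apply: (@ratio_test _ (fun i => nm (qbin B C i)) c (nm C)) => //.
- by move=> i; exact: nm_ge0.
- rewrite -[X in _ --> X]divr1; apply: cvgM.
    rewrite -[C in nm C]subr0 -(mulr0 B); apply: tends_nm.
    exact: tendsB (tends_cst C) (tendsM (tends_cst B) qX_to0).
  apply: cvgV; first exact: oner_neq0.
  rewrite -(nm1 R) -[1 in X in _ --> X]subr0; apply: tends_nm.
  by apply: tendsB (tends_cst _) _; apply/tendsS; exact: qX_to0.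
- near=> i; rewrite /qbin big_ord_recr /= nmM mulrC /c.
  by rewrite nmM nmV.
Unshelve. all: by end_near. Qed.

Lemma qbin_rec B C i :
  mul1BX C (qbin B C) i = mul1BX B (fun j => qbin B C j * q ^+ j) i.
Proof.
rewrite /mul1BX; case: i => [|i] /=; first by rewrite !mulr0 expr0 mulr1.
rewrite /qbin big_ord_recr /= exprS.
by field; rewrite -exprS one_sub_qS_neq0.
Qed.

Lemma qbin_step B C y : nm C * nm y < 1 ->
  (1 - C * y) * psum (qbin B C) y = (1 - B * y) * psum (qbin B C) (q * y).
Proof.
move=> Cy; have C0 := nm_ge0 C; have g := @qbin_growth B C.
have g' : growth (nm C) (fun j => qbin B C j * q ^+ j).
  move=> rho /g[M hM]; exists M => i; apply: le_trans (hM i).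
  by rewrite nmM nmX ler_piMr ?nm_ge0// exprn_ile1 ?nm_ge0// ltW.
have -> : psum (qbin B C) (q * y) = psum (fun j => qbin B C j * q ^+ j) y.
  by apply: eq_psum => i; rewrite exprMn mulrA.
rewrite -(psum_mul1BX _ C0 g Cy) -(psum_mul1BX _ C0 g' Cy).
by apply: eq_psum => i; rewrite qbin_rec.
Qed.

Lemma qbin_iter B C y n : nm C * nm y < 1 ->
  qpoch (C * y) q n * psum (qbin B C) y =
  qpoch (B * y) q n * psum (qbin B C) (q ^+ n * y).
Proof.
move=> Cy; elim: n => [|n IH].
  by rewrite ![qpoch _ _ 0]big_ord0 expr0 !mul1r.
have qy : nm (q ^+ n * y) <= nm y.
  by rewrite nmM nmX ler_piMl ?nm_ge0 ?exprn_ile1 ?nm_ge0 ?(ltW q1).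
have Cn : nm C * nm (q ^+ n * y) < 1.
  exact: le_lt_trans (ler_wpM2l (nm_ge0 C) qy) Cy.
have cE z : z * y * q ^+ n = z * (q ^+ n * y) by rewrite mulrAC -mulrA.
move: IH (qbin_step B Cn); rewrite !qpochS exprS -[q * _ * y]mulrA !cE.
move: (psum _ y) (psum _ (q ^+ n * y)) (psum _ (q * _)) => p0 p1 p2.
move: (C * (q ^+ n * y)) (B * (q ^+ n * y)) (qpoch _ q n) (qpoch _ q n).
move=> u v U V IH E.
by rewrite mulrAC IH mulrAC -!mulrA -E.
Qed.

Lemma qbin0 B C : qbin B C 0 = 1.
Proof. by rewrite /qbin big_ord0. Qed.

Lemma qbin_lim B C y : nm C * nm y < 1 ->
  tends (fun n => psum (qbin B C) (q ^+ n * y)) 1.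
Proof.
move=> Cy; rewrite -(qbin0 B C).
exact: psum_at0 (nm_ge0 C) (@qbin_growth B C) q1.
Qed.

(** The case [C = 0], [y = 1] of [qbin_iter] expresses [(x; q)_n] as a quotient
    of values of a power series, whose denominators tend to 1. *)
Lemma qpoch_cvg x : tends (qpoch x q) (qpochoo x q).
Proof.
have C1 : nm (0 : R[i]) * nm (1 : R[i]) < 1 by rewrite nm0 mul0r.
have l1 := qbin_lim x C1.
suff h : tends (qpoch x q) (psum (qbin x 0) 1).
  by rewrite /qpochoo (tends_lim h).
have := tendsM (tends_cst (psum (qbin x 0) 1)) (tendsV (oner_neq0 _) l1).
rewrite invr1 mulr1; apply: cvg_trans; apply: near_eq_cvg.
have ne0 : \forall n \near \oo, 2^-1 < nm (psum (qbin x 0) (q ^+ n * 1)).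
  apply: (cvgr_gt _ (tends_nm l1)); rewrite nm1; lra.
near=> n.
have p0 : psum (qbin x 0) (q ^+ n * 1) != 0.
  rewrite -nm_gt0; apply: lt_trans (_ : 2^-1 < _); first by rewrite invr_gt0.
  by near: n.
have := qbin_iter x n C1; rewrite mul0r qpoch0 mul1r mulr1 => ->.
by rewrite mulfK.
Unshelve. all: by end_near. Qed.

(** Iterating the functional equation
    [(1 - C y) f(y) = (1 - B y) f(q y)] of [qbin_step] moves the argument to the
    origin, where [f] is 1. *)
Theorem qbinomial B C y : nm C * nm y < 1 ->
  qpochoo (C * y) q * psum (qbin B C) y = qpochoo (B * y) q.
Proof.
move=> Cy; apply: tends_uniq
  (tendsM (@qpoch_cvg (C * y)) (tends_cst (psum (qbin B C) y))) _.
apply: eq_tends (fun n => esym (qbin_iter B n Cy)) _.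
rewrite -[X in tends _ X]mulr1.
exact: tendsM (@qpoch_cvg (B * y)) (qbin_lim B Cy).
Qed.

(** By the q-binomial theorem with [B = 0] the product has an inverse. *)
Lemma qpochoo_neq0 z : nm z < 1 -> qpochoo z q != 0.
Proof.
move=> z1; have z1' : nm z * nm (1 : R[i]) < 1 by rewrite nm1 mulr1.
have := qbinomial 0 z1'; rewrite mul0r qpochoo0 mulr1 => E.
by apply: contra_eq_neq E => ->; rewrite mul0r eq_sym oner_neq0.
Qed.

Lemma qpochoo_split x n : qpochoo x q = qpoch x q n * qpochoo (x * q ^+ n) q.
Proof.
apply: tends_uniq (@qpoch_cvg x) _; rewrite /tends -(cvg_shiftn n).
have := tendsM (tends_cst (qpoch x q n)) (@qpoch_cvg (x * q ^+ n)).
by apply: eq_tends => k; rewrite -qpochD addnC.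
Qed.

(** Each pair contributes a Cauchy product with a q-binomial series. The single
    radius [r] serves all of them, so that the interpolation can be run in one
    disc. *)
Lemma qproduct_series (ps : seq (R[i] * R[i])) (c : R[i]) (l : nat) (r : R) :
  0 <= r -> (forall p, p \in ps -> nm p.2 <= r) ->
  exists2 h, growth r h & forall y, r * nm y < 1 ->
    psum h y = y ^+ l * c *
      \prod_(p <- ps) (qpochoo (p.1 * y) q / qpochoo (p.2 * y) q).
Proof.
move=> r0; elim: ps => [|[B C] ps IH] hps.
  elim: l => [|l [h gh hE]].
    exists (fun i => if i == 0%N then c else 0).
      move=> rho rrho; exists (nm c) => -[|i].
        by rewrite expr0 mulr1.
      by rewrite -[X in nm X]/(0 : R[i]) nm0 mulr_ge0 ?nm_ge0//
        exprn_ge0// (le_trans r0)// ltW.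
    move=> y _; rewrite big_nil expr0 mul1r mulr1; apply: tends_lim.
    apply/tendsS; apply: eq_tends (fun n => _) (tends_cst c) => n.
    rewrite /series /= big_nat_recl//= expr0 mulr1 big1 ?addr0// => i _.
    by rewrite mul0r.
  exists (mulX h); first exact: growth_mulX.
  by move=> y ry; rewrite (psum_mulX r0 gh ry) hE// exprS !mulrA.
have [p pps|h gh hE] := IH; first by apply: hps; rewrite inE pps orbT.
have Cr : nm C <= r by apply: (hps (B, C)); rewrite inE eqxx.
have gb : growth r (qbin B C).
  by move=> rho rrho; apply: qbin_growth; exact: le_lt_trans rrho.
exists (cauchy_prod h (qbin B C)); first exact: growth_cauchy_prod.
move=> y ry; rewrite (psum_cauchy_prod r0 gh gb ry) hE// big_cons.
have Cy : nm C * nm y < 1.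
  by apply: le_lt_trans ry; rewrite ler_wpM2r// nm_ge0.
have Cy0 : qpochoo (C * y) q != 0 by rewrite qpochoo_neq0// nmM.
rewrite -(qbinomial B Cy) /=; by field.
Qed.

End QBinomial.

(** * The expansion *)

Section Expansion.
Variable R : realType.
Variable q : R[i].
Hypothesis q_neq0 : q != 0.
Hypothesis q1 : nm q < 1.
Implicit Types (alpha a b y : R[i]) (ps : seq (R[i] * R[i])).

Lemma qX_inj : injective (fun k => q ^+ k).
Proof.
move=> i j /(congr1 (fun z => nm z)); rewrite !nmX.
by apply: ieexprIn; rewrite ?nm_gt0// lt_eqF.
Qed.

(** At the node [q ^+ k] the infinite products telescope to finite ones. A
    factor [(C; q)_oo] that vanishes is harmless, since only [(C q^k; q)_oo] is
    divided out. *)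
Lemma qprod_at_node ps (l k : nat) (r : R) :
  (forall p, p \in ps -> nm p.1 < 1 /\ nm p.2 <= r) -> r * nm (q ^+ k) < 1 ->
  (q ^+ k) ^+ l * \prod_(p <- ps) (qpochoo p.2 q / qpochoo p.1 q) *
    \prod_(p <- ps) (qpochoo (p.1 * q ^+ k) q / qpochoo (p.2 * q ^+ k) q) =
  (q ^+ k) ^+ l * \prod_(p <- ps) (qpoch p.2 q k / qpoch p.1 q k).
Proof.
move=> hps rk; rewrite -mulrA -big_split /=; congr (_ * _).
apply: eq_big_seq => -[B C] /hps[/= B1 Cr].
have Bk : qpochoo (B * q ^+ k) q != 0 by rewrite qpochoo_neq0// nm_qX.
have Ck : qpochoo (C * q ^+ k) q != 0.
  rewrite qpochoo_neq0// nmM; apply: le_lt_trans rk.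
  exact: ler_wpM2r (nm_ge0 _) _ _ Cr.
have Bk0 := qpoch_neq0 q1 k B1.
rewrite (qpochoo_split q1 C k) (qpochoo_split q1 B k).
move: Bk Ck Bk0; move: (qpochoo _ q) (qpochoo _ q) (qpoch B q k) (qpoch C q k).
move=> u v w z u0 v0 w0.
by field; rewrite u0 v0 w0.
Qed.

Lemma pole_to0 alpha : tends (pole q alpha) 0.
Proof.
apply/tendsS; rewrite -(mulr0 alpha); apply: tendsM (tends_cst alpha) _.
by apply/tendsS; exact: qX_to0.
Qed.

Lemma prod_pole alpha a n :
  \prod_(j < n.+1) (1 - pole q alpha j * (a / q)) = qpoch (alpha * a) q n.
Proof.
rewrite big_ord_recl /= /pole eqxx mul0r subr0 mul1r.
by apply: eq_bigr => i _; rewrite /= exprS; field.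
Qed.

Lemma prod_sub_node a n : \prod_(j < n) (a / q - q ^+ j) = qpochdiv a q n.
Proof.
rewrite /qpochdiv big_add1 /= big_mkord -exprVn.
have -> : q^-1 ^+ n = \prod_(j < n) q^-1 by rewrite prodr_const card_ord.
rewrite -big_split /=; apply: eq_bigr => i _.
by rewrite exprS mulrBr mulKf// mulrC.
Qed.

Lemma qpochs_family (m : nat) (F : 'I_m -> R[i]) k :
  qpochs [tuple F j | j < m] q k = \prod_(j < m) qpoch (F j) q k.
Proof.
by rewrite /qpochs big_tuple; apply: eq_bigr => j _; rewrite tnth_mktuple.
Qed.

Section Term.
Variables (m l : nat) (alpha a b : R[i]) (bs cs : 'I_m -> R[i]).
Hypothesis aa1 : nm (alpha * a) < 1.
Hypothesis ab1 : nm (alpha * b) < 1.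
Hypothesis bs1 : forall j, nm (alpha * bs j) < 1.

(** The pair [(0, alpha q)] accounts for the factor
    [(alpha q; q)_oo / (alpha a; q)_oo], and [(alpha b, 0)] for the factor with
    [b]; so these are treated like the parameters [b_j] and [c_j]. *)
Definition node_pairs : seq (R[i] * R[i]) :=
  [:: (0, alpha * q), (alpha * b, 0)
    & [seq (alpha * bs j, alpha * cs j) | j <- index_enum 'I_m]].

Definition node_value k : R[i] :=
  (q ^+ k) ^+ l * \prod_(p <- node_pairs) (qpoch p.2 q k / qpoch p.1 q k).

(** The identity behind the theorem: its summand is the Newton term of the
    values [node_value] at the nodes [q ^+ k]. *)
Lemma term_divdiff n :
  verywell alpha q n * qpochdiv a q n / qpochs [:: q; alpha * a] q n
  * qhyper
      [tuple of q ^- n :: alpha * q ^+ n :: [tuple alpha * cs j | j < m]]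
      [tuple of alpha * b :: [tuple alpha * bs j | j < m]] q (q ^+ l.+1) =
  (1 - pole q alpha n * q ^+ n)
  * divdiff (fun k => q ^+ k) (pole q alpha) node_value n n
  * \prod_(j < n) (a / q - q ^+ j)
  / \prod_(j < n.+1) (1 - pole q alpha j * (a / q)).
Proof.
rewrite prod_pole prod_sub_node (qhyperN _ _ q_neq0 (n := n)); last first.
  by rewrite /= inE eqxx.
rewrite (divdiff_diag _ _ qX_inj).
have qn0 : qpoch q q n != 0 by exact: qpoch_neq0.
have an0 : qpoch (alpha * a) q n != 0 by exact: qpoch_neq0.
rewrite [qpochs [:: _; _] _ _]/qpochs !big_cons big_nil mulr1.
set S := \sum_(k < n.+1) _; set T := \sum_(k < n.+1) _.
suff E : verywell alpha q n / qpoch q q n * S =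
    (1 - pole q alpha n * q ^+ n) * T.
  by rewrite -E; field; rewrite an0 qn0.
rewrite !mulr_sumr; apply: eq_bigr => k _.
have kn : (k <= n)%N by rewrite -ltnS.
rewrite /node_value /node_pairs !big_cons big_map /= qpoch0.
have bE : \prod_(j < m) (qpoch (alpha * cs j) q k / qpoch (alpha * bs j) q k) =
  \prod_(j < m) qpoch (alpha * cs j) q k
    / \prod_(j < m) qpoch (alpha * bs j) q k.
  by rewrite prodf_div.
rewrite bE {bE}.
rewrite /qpochs !big_cons -!/(qpochs _ q k) !qpochs_family.
have E1 := prod_nodes q_neq0 kn.
have E2 := verywell_shift alpha q kn.
have qk0 : qpoch q q k != 0 by exact: qpoch_neq0.
have bk0 : qpoch (alpha * b) q k != 0 by exact: qpoch_neq0.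
have B0 : \prod_(j < m) qpoch (alpha * bs j) q k != 0.
  by apply/prodf_neq0 => j _; exact: qpoch_neq0.
have W0 : \prod_(i < n.+1 | i != k :> nat) (q ^+ k - q ^+ i) != 0.
  apply/prodf_neq0 => i ik; rewrite subr_eq0; apply: contra_neq ik.
  by move=> /qX_inj.
have -> : (q ^+ l.+1) ^+ k = q ^+ k * (q ^+ k) ^+ l.
  by rewrite exprS exprMn -!exprM mulnC.
move: E1 E2 qn0 qk0 bk0 B0 W0.
set F := \prod_(i < n) _.
set W := \prod_(i < n.+1 | _) _.
set B := \prod_(j < m) _; set A := \prod_(j < m) _.
move: F W A B => F W A B.
move: (qpoch (q ^- n) q k) (qpoch (alpha * q ^+ n) q k) (qpoch (alpha * q) q k)
  (qpoch q q k) (qpoch q q n) (qpoch (alpha * b) q k) (verywell _ _ _)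
  (1 - pole q alpha n * q ^+ n) (q ^+ k) ((q ^+ k) ^+ l).
move=> c1 c2 c3 c4 c5 c6 c7 c8 c9 c10 E1 E2 c50 c40 c60 B0 W0.
transitivity ((c7 * c2) * (c1 * c9 * W) / (c4 * c5) * c10 * A / (c6 * B * W)).
  by field; rewrite B0 W0 c40 c50 c60.
rewrite E1 E2; by field; rewrite B0 W0 c40 c50 c60.
Qed.

End Term.
End Expansion.

Lemma common_radius (R : realType) (ps : seq (R[i] * R[i])) (y : R[i]) :
  (forall p, p \in ps -> nm p.2 * nm y < 1) ->
  exists r : R, [/\ 0 <= r, forall p, p \in ps -> nm p.2 <= r & r * nm y < 1].
Proof.
elim: ps => [|p0 ps IH] hps; first by exists 0; rewrite mul0r; split.
have [p pps|r [r0 rps ry]] := IH; first by apply: hps; rewrite inE pps orbT.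
exists (Num.max r (nm p0.2)); split.
- by rewrite le_max r0.
- move=> p; rewrite inE le_max => /orP[/eqP ->|/rps ->//].
  by rewrite lexx orbT.
- by rewrite maxEle; case: ifP => _ //; apply: hps; rewrite inE eqxx.
Qed.

Lemma qpochsoo2 (K : numFieldType) (x z q : K) :
  qpochsoo [:: x; z] q = qpochoo x q * qpochoo z q.
Proof. by rewrite /qpochsoo !big_cons big_nil mulr1. Qed.

Theorem theorem1p3 (R : realType) (q : R) (m l : nat)
    (alpha a b : R[i]) (bs cs : 'I_m -> R[i]) :
  0 < q < 1 ->
  `|alpha * a| < 1 -> `|alpha * b| < 1 ->
  (forall j : 'I_m, `|alpha * bs j| < 1) ->
  (forall j : 'I_m, `|alpha * a * cs j / q%:C| < 1) ->
  sums_to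
    (fun n =>
       verywell alpha q%:C n * qpochdiv a q%:C n
       / qpochs [:: q%:C; alpha * a] q%:C n
       * qhyper
           [tuple of q%:C ^- n :: alpha * q%:C ^+ n
                       :: [tuple alpha * cs j | j < m]]
           [tuple of alpha * b :: [tuple alpha * bs j | j < m]]
           q%:C (q%:C ^+ l.+1))
    ((a / q%:C) ^+ l
     * (qpochsoo [:: alpha * q%:C; alpha * a * b / q%:C] q%:C
        / qpochsoo [:: alpha * a; alpha * b] q%:C)
     * \prod_(j < m)
         (qpochsoo [:: alpha * a * bs j / q%:C; alpha * cs j] q%:C
          / qpochsoo [:: alpha * a * cs j / q%:C; alpha * bs j] q%:C)).
Proof.
move=> /andP[q0 q_lt1] aa ab hb hc.
have Q0 : q%:C != 0 :> R[i] by rewrite eq_complex /= eqxx andbT gt_eqF.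
have Q1 : nm q%:C < 1 by rewrite nm_real gtr0_norm.
move: q%:C Q0 Q1 hc => {q0 q_lt1 q} q q0 q1 hc.
have {}aa : nm (alpha * a) < 1 by rewrite -nm_lt1.
have {}ab : nm (alpha * b) < 1 by rewrite -nm_lt1.
have {}hb j : nm (alpha * bs j) < 1 by rewrite -nm_lt1.
have {}hc j : nm (alpha * a * cs j / q) < 1 by rewrite -nm_lt1.
have [y yE] : exists y, y = a / q by exists (a / q).
have aqy : alpha * q * y = alpha * a by rewrite yE; field.
have csy j : alpha * cs j * y = alpha * a * cs j / q by rewrite yE; field.
pose ps := node_pairs q alpha b bs cs.
have [|r [r0 rps ry]] := @common_radius _ ps y.
  move=> p; rewrite !inE -nmM => /or3P[/eqP ->|/eqP ->|/mapP[j _ ->]] /=.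
  - by rewrite aqy.
  - by rewrite mul0r nm0.
  - by rewrite csy.
have psB p : p \in ps -> nm p.1 < 1.
  have n0 : nm (0 : R[i]) < 1 by rewrite nm0.
  by rewrite !inE => /or3P[/eqP ->|/eqP ->|/mapP[j _ ->]]; rewrite ?n0 /= ?hb.
pose c := \prod_(p <- ps) (qpochoo p.2 q / qpochoo p.1 q).
have [h gh hE] := qproduct_series q1 c l r0 rps.
have hd k : r * nm (q ^+ k) < 1 ->
    psum h (q ^+ k) = node_value q l alpha b bs cs k.
  move=> rk; rewrite hE// (qprod_at_node q1 _ _ rk)// => p pps; split.
    exact: psB.
  exact: rps.
have sy n : 1 - pole q alpha n * y != 0.
  case: n => [|n]; first by rewrite /pole mul0r subr0 oner_neq0.
  rewrite /pole /= (_ : _ * y = alpha * a * q ^+ n) ?one_sub_neq0 ?nm_qX//.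
  by rewrite -aqy exprS; ring.
have := newton_cvg (qX_inj q0 q1) (fun n => expf_neq0 n q0) (qX_to0 q1)
  (pole_to0 q1 alpha) r0 gh hd ry sy.
have -> : psum h y = (a / q) ^+ l
     * (qpochsoo [:: alpha * q; alpha * a * b / q] q
        / qpochsoo [:: alpha * a; alpha * b] q)
     * \prod_(j < m)
         (qpochsoo [:: alpha * a * bs j / q; alpha * cs j] q
          / qpochsoo [:: alpha * a * cs j / q; alpha * bs j] q).
  have split2 (t u v w : R[i]) :
      t / 1 * (1 / u) * (1 / v * (w / 1)) = t * w / (u * v).
    by rewrite invfM invr1; ring.
  have swap (t u v w : R[i]) : t / u * (v / w) = v * t / (w * u).
    by rewrite invfM; ring.
  have aby : alpha * b * y = alpha * a * b / q by rewrite yE; field.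
  have bsy j : alpha * bs j * y = alpha * a * bs j / q by rewrite yE; field.
  rewrite -yE hE// -mulrA -[RHS]mulrA; congr (_ * _).
  rewrite -big_split /= /ps /node_pairs !big_cons big_map /= [LHS]mulrA.
  rewrite !qpochsoo2 !mul0r qpochoo0 aqy aby split2.
  congr (_ * _); apply: eq_bigr => j _.
  by rewrite !qpochsoo2 csy bsy swap.
congr (tends (series _) _); apply/funext => n.
by rewrite yE -term_divdiff.
Qed.
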